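(* Let $n\in\mathbb{Z}_{\ge 1}$, $k\in\{1,\dots,n\}$ and $r\in(k-1,k]$. The polynomial $$ A_{k,r}(\mathbf{x})=(|\mathbf{x}|-r)\prod_{j=0}^{k-1}(|\mathbf{x}|-j),\qquad \mathbf{x}=(x_1,\dots,x_n), $$ has an SOS certificate over $\{0,1\}^n$ of degree $O(k)$, where the implied constant is absolute.
   Context: Here $|\mathbf{x}|=\sum_{i=1}^n x_i$. A polynomial $p\in\mathbb{R}[x_1,\dots,x_n]$ has an SOS certificate over $\{0,1\}^n$ of degree $D$ if there is a polynomial $s$ that is a finite sum of squares of real polynomials in $x_1,\dots,x_n$, with $\deg(s)\le D$, such that $p(\mathbf{x})=s(\mathbf{x})$ for all $\mathbf{x}\in\{0,1\}^n$. *)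

(* Defs.v *)
From HB Require Import structures.
From mathcomp Require Import all_boot all_order all_algebra.
From mathcomp Require Import reals.
From mathcomp Require Import mpoly.

Set Implicit Arguments.
Unset Strict Implicit.
Unset Printing Implicit Defensive.

Import Order.TTheory GRing.Theory Num.Theory.

Local Open Scope ring_scope.

Definition is_sos (R : realType) (n : nat) (s : {mpoly R[n]}) : Prop :=
  exists qs : seq {mpoly R[n]}, s = \sum_(q <- qs) q ^+ 2.

Definition hypercube_point (R : realType) (n : nat) (x : 'I_n -> R) : Prop :=
  forall i : 'I_n, x i = 0 \/ x i = 1.

(* [msize s] is [deg s + 1], and [0] when [s = 0]. *)
Definition sos_certificate (R : realType) (n : nat) (p : {mpoly R[n]})
    (D : nat) : Prop :=
  exists s : {mpoly R[n]},
    [/\ is_sos s,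
        (msize s <= D.+1)%N
      & forall x : 'I_n -> R, hypercube_point x -> p.@[x] = s.@[x]].

Definition abs_x (R : realType) (n : nat) : {mpoly R[n]} := \sum_(i < n) 'X_i.

Definition A_poly (R : realType) (n k : nat) (r : R) : {mpoly R[n]} :=
  (abs_x R n - r%:MP) * \prod_(j < k) (abs_x R n - (j%:R : R)%:MP).

(* Main.v *)
Require Import Defs.
From HB Require Import structures.
From mathcomp Require Import all_boot all_order all_algebra.
From mathcomp Require Import reals.
From mathcomp Require Import mpoly.
From mathcomp Require Import ring.

(** On the hypercube, [x_i ^+ 2 = x_i] makes the falling factorial
    [|x| (|x| - 1) ... (|x| - k + 1)] equal to the sum of the squares of the
    monomials [x_(i_1) ... x_(i_k)] over all tuples of distinct indices.
    Splitting [|x| - r] as [(|x| - k) + (k - r)] writes [A_(k,r)] as the falling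
    factorial of order [k + 1] plus a nonnegative multiple of that of order [k],
    so degree [2 (k + 1) <= 4 k] suffices. *)

Set Implicit Arguments.
Unset Strict Implicit.
Unset Printing Implicit Defensive.

Import Order.TTheory GRing.Theory Num.Theory.

Local Open Scope ring_scope.

(** Words are ordered, so each [k]-subset is listed [k!] times: this gives the falling factorial
    itself, with no division by [k!]. Growing words at the head suits induction on [k]. *)
Fixpoint uniq_words (T : finType) (k : nat) : seq (seq T) :=
  if k is k'.+1 then
    [seq i :: s | s <- uniq_words T k', i <- [seq i <- enum T | i \notin s]]
  else [:: [::]].

Lemma size_uniq_words (T : finType) (k : nat) (s : seq T) :
  s \in uniq_words T k -> uniq s /\ size s = k.
Proof.
elim: k s => [|k IHk] s /=; first by rewrite inE => /eqP->.
case/allpairsPdep=> t [i [/IHk[ut st]]].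
by rewrite mem_filter => /andP[it _] ->; rewrite /= it ut st.
Qed.

Lemma mul_idem_prod (R : comNzRingType) (T : eqType) (x : T -> R) (i : T)
    (s : seq T) :
  x i ^+ 2 = x i -> i \in s ->
  x i * \prod_(j <- s) x j = \prod_(j <- s) x j.
Proof. by move=> xi is_; rewrite (big_rem i) //= mulrA -expr2 xi. Qed.

(** Extending a word [s] multiplies its monomial by the sum of [x i] over [i] outside [s], that is,
    the full sum minus the sum over [s]. *)
Lemma sum_uniq_words (R : comNzRingType) (T : finType) (x : T -> R) (k : nat) :
  (forall i, x i ^+ 2 = x i) ->
  \sum_(s <- uniq_words T k) \prod_(i <- s) x i =
  \prod_(j < k) (\sum_i x i - j%:R).
Proof.
move=> idem_x; elim: k => [|k IHk]; first by rewrite big_seq1 big_nil big_ord0.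
rewrite big_ord_recr -IHk /= big_allpairs_dep /= mulr_suml.
apply: eq_big_seq => s /size_uniq_words[us ss].
rewrite big_filter big_enum_cond /=.
under eq_bigr do rewrite big_cons.
rewrite -mulr_suml [RHS]mulrC.
have -> : \sum_i x i = \sum_(i in s) x i + \sum_(i | i \notin s) x i.
  by rewrite (bigID (mem s)).
(* By idempotence, the monomial absorbs each of the [k] distinct letters of [s]. *)
have: (\sum_(i in s) x i) * \prod_(i <- s) x i = k%:R * \prod_(i <- s) x i.
  rewrite -big_uniq //= mulr_suml.
  rewrite (eq_big_seq (fun=> \prod_(j <- s) x j)) => [|i]; last first.
    exact: mul_idem_prod.
  by rewrite big_const_seq count_predT ss iter_addr_0 mulr_natl.
by rewrite mulrBl mulrDl => ->; rewrite addrAC subrr add0r.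
Qed.

Section SumsOfSquares.
Variables (R : realType) (n : nat).
Implicit Types p q : {mpoly R[n]}.

Lemma is_sosD p q : is_sos p -> is_sos q -> is_sos (p + q).
Proof. by move=> [ps ->] [ss ->]; exists (ps ++ ss); rewrite big_cat. Qed.

Lemma is_sosZ (c : R) p : 0 <= c -> is_sos p -> is_sos (c *: p).
Proof.
move=> c_ge0 [ps ->]; exists [seq Num.sqrt c *: q | q <- ps].
rewrite big_map scaler_sumr; apply: eq_bigr => q _.
by rewrite exprZn sqr_sqrtr.
Qed.

Definition ffact_sos (k : nat) : {mpoly R[n]} :=
  \sum_(s <- uniq_words 'I_n k) (\prod_(i <- s) 'X_i) ^+ 2.

Lemma is_sos_ffact k : is_sos (ffact_sos k).
Proof.
by exists [seq \prod_(i <- s) 'X_i | s <- uniq_words 'I_n k]; rewrite big_map.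
Qed.

Lemma msize_ffact_sos k : (msize (ffact_sos k) <= (2 * k).+1)%N.
Proof.
rewrite /ffact_sos big_seq; apply: (leq_trans (msize_sum _ _ _)).
apply/bigmax_leqP_seq => s _ /size_uniq_words[_ ss].
(* Each summand is a single monomial of degree [2 * size s], and its [msize] is one more. *)
rewrite mprodXE mpolyXn msizeX mdegMn mdeg_sum ltnS mulnC leq_mul2l -ss.
by under eq_bigr do rewrite mdeg1; rewrite sum1_size leqnn.
Qed.

Lemma meval_ffact_sos k (x : 'I_n -> R) : hypercube_point x ->
  (ffact_sos k).@[x] = \prod_(j < k) (\sum_i x i - j%:R).
Proof.
move=> hx; have idem_x i : x i ^+ 2 = x i.
  by case: (hx i) => ->; rewrite ?expr0n ?expr1n.
rewrite -sum_uniq_words // raddf_sum; apply: eq_bigr => s _ /=.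
rewrite rmorphXn rmorph_prod /= -prodrXl.
by apply: eq_bigr => i _; rewrite mevalXU idem_x.
Qed.

End SumsOfSquares.

Theorem lemma4p2 :
  exists C : nat,
    forall (R : realType) (n k : nat) (r : R),
      (1 <= n)%N ->
      (1 <= k <= n)%N ->
      k%:R - 1 < r <= k%:R ->
      sos_certificate (A_poly n k r) (C * k)%N.
Proof.
exists 4%N => R n k r _ /andP[k_gt0 _] /andP[_ r_le_k].
(* The coefficient [k%:R - r] is nonnegative because [r <= k%:R]. *)
exists (ffact_sos R n k.+1 + (k%:R - r) *: ffact_sos R n k); split.
- by apply/is_sosD/is_sosZ; rewrite ?subr_ge0 //; apply: is_sos_ffact.
- apply: leq_trans (msizeD_le _ _) _; rewrite geq_max; apply/andP; split.
    apply: leq_trans (msize_ffact_sos _ _ _) _.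
    (* After halving, [k + 1 <= k + k] is exactly [0 < k]. *)
    by rewrite ltnS -[4%N]/(2 * 2)%N -mulnA leq_mul2l /= mul2n -addnn -addn1 leq_add2l.
  apply: leq_trans (msizeZ_le _ _) (leq_trans (msize_ffact_sos _ _ _) _).
  by rewrite ltnS leq_mul2r orbT.
move=> x hx.
rewrite mevalD mevalZ !meval_ffact_sos // big_ord_recr /=.
have abs_xE : (abs_x R n).@[x] = \sum_i x i.
  by rewrite raddf_sum; apply: eq_bigr => i _ /=; rewrite mevalXU.
have prodE : (\prod_(j < k) (abs_x R n - (j%:R : R)%:MP)).@[x] =
    \prod_(j < k) (\sum_i x i - j%:R).
  rewrite rmorph_prod; apply: eq_bigr => j _ /=.
  by rewrite mevalB mevalC abs_xE.
rewrite /A_poly mevalM mevalB mevalC abs_xE prodE.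
(* Both sides are the order-[k] product times [|x| - r]. *)
ring.
Qed.
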